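(* Assume $T$ is stable. Let $p\in S_m(A)$ be a stationary type and let $I=(\bar a_n)_{n\in\mathbb N}$ be a Morley sequence in $p$. Then $\mathrm{tdcl}^{eq}(I)$ is a canonical base of $p$, i.e., $\mathrm{dcl}^{eq}(\mathrm{tdcl}^{eq}(I))=\mathrm{dcl}^{eq}(\mathrm{Cb}(p))$.
   Context: Continuous first order logic: formulas take values in $[0,1]$; $T$ a continuous theory, stable if no formula has the order property in any model of $T$; work in a monster model. $\mathrm{dcl}^{eq}$ is definable closure with imaginary sorts for canonical parameters of definable predicates. Independence $\bar a\perp_A\bar b$ means $\mathrm{tp}(\bar a/A\bar b)$ does not fork over $A$ (non-forking: each $\varphi$-restriction extends to a $\varphi$-type over a model whose definition is over $\mathrm{acl}^{eq}(A)$). A type over $A$ is stationary if it has a unique non-forking extension to every superset; for stationary $p$, $\mathrm{Cb}(p)$ is the set of canonical parameters of the $\varphi$-definitions of its non-forking extension to a model. A Morley sequence in $p\in S_m(A)$ is a sequence $(\bar a_n)_{n\in\mathbb N}$ of realisations of $p$ with $\bar a_n\perp_A\bar a_{<n}$ for all $n$. For a sequence $I=(\bar a_n)_{n\in\mathbb N}$, $I^{\ge k}=(\bar a_n)_{n\ge k}$ and $\mathrm{tdcl}^{eq}(I)=\bigcap_{k\in\mathbb N}\mathrm{dcl}^{eq}(I^{\ge k})$. *)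

(* Defs.v *)
From HB Require Import structures.
From mathcomp Require Import all_boot all_order all_algebra.
From mathcomp Require Import all_classical all_reals all_analysis.

Set Implicit Arguments.
Unset Strict Implicit.
Unset Printing Implicit Defensive.

Import Order.TTheory GRing.Theory Num.Theory.
Import numFieldNormedType.Exports.

Local Open Scope classical_set_scope.
Local Open Scope ring_scope.

(* A modulus [w] bounds the variation of a symbol by [e] on tuples whose
   coordinates are pairwise at distance less than [w e]. *)
Record language (R : realType) := Language {
  fsym : Type;
  psym : Type;
  far : fsym -> nat;
  par : psym -> nat;
  fmod : fsym -> R -> R;
  pmod : psym -> R -> R;
  fmod_gt0 : forall f e, 0 < e -> 0 < fmod f e;
  pmod_gt0 : forall P e, 0 < e -> 0 < pmod P e }.

Section Syntax.
Context {R : realType} (L : language R).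

Inductive term (V : Type) : Type :=
| tvar of V
| tapp (f : fsym L) of ('I_(far f) -> term V).

(* [formula V] is the type of formulas whose free variables are in [V]; the
   quantifiers bind the variable [None] of [option V]. The connectives are
   1 - x, x / 2 and max(x - y, 0); they generate a dense set of the continuous
   connectives, so they yield the same definable predicates. *)
Inductive formula (V : Type) : Type :=
| fdist of term V & term V
| fpred (P : psym L) of ('I_(par P) -> term V)
| fneg of formula V
| fhalf of formula V
| fsubt of formula V & formula V
| fsup of formula (option V)
| finf of formula (option V).

Fixpoint term_map (V W : Type) (g : V -> W) (t : term V) : term W :=
  match t with
  | tvar x => tvar (g x)
  | tapp f ts => tapp (fun i => term_map g (ts i))
  end.

Fixpoint formula_map (V W : Type) (g : V -> W) (phi : formula V) {struct phi} :
    formula W :=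
  match phi with
  | fdist s t => fdist (term_map g s) (term_map g t)
  | fpred P ts => fpred (fun i => term_map g (ts i))
  | fneg phi1 => fneg (formula_map g phi1)
  | fhalf phi1 => fhalf (formula_map g phi1)
  | fsubt phi1 phi2 => fsubt (formula_map g phi1) (formula_map g phi2)
  | fsup phi1 => fsup (formula_map (option_map g) phi1)
  | finf phi1 => finf (formula_map (option_map g) phi1)
  end.

(* The pair [(phi, r)] stands for the condition phi <= r. *)
Definition condition (V : Type) : Type := formula V * R.

Definition theory := set (condition void).

End Syntax.

Record structure (R : realType) (L : language R) := Structure {
  car :> metricType R;
  car_inh : inhabited car;
  car_complete : forall F : set_system car, ProperFilter F -> cauchy F ->
    exists l : car, F --> l;
  car_diam : forall x y : car, mdist x y <= 1;
  fint : forall f : fsym L, ('I_(far f) -> car) -> car;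
  pint : forall P : psym L, ('I_(par P) -> car) -> R;
  pint_range : forall (P : psym L) x, 0 <= pint (P := P) x <= 1;
  fint_unif : forall (f : fsym L) e x y, 0 < e ->
    (forall i, mdist (x i) (y i) < fmod f e) ->
    mdist (fint (f := f) x) (fint (f := f) y) <= e;
  pint_unif : forall (P : psym L) e x y, 0 < e ->
    (forall i, mdist (x i) (y i) < pmod P e) ->
    `|pint (P := P) x - pint (P := P) y| <= e }.

Definition vsum (V W T : Type) (a : V -> T) (b : W -> T) (x : V + W) : T :=
  match x with inl i => a i | inr j => b j end.

Definition vcons (V T : Type) (t : T) (v : V -> T) (x : option V) : T :=
  if x is Some y then v y else t.

Section Semantics.
Context {R : realType} {L : language R} (M : structure L).

Fixpoint teval (V : Type) (t : term L V) (v : V -> M) : M :=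
  match t with
  | tvar x => v x
  | tapp f ts => fint (fun i => teval (ts i) v)
  end.

Fixpoint eval (V : Type) (phi : formula L V) (v : V -> M) {struct phi} : R :=
  match phi with
  | fdist s t => mdist (teval s v) (teval t v)
  | fpred P ts => pint (fun i => teval (ts i) v)
  | fneg phi1 => 1 - eval phi1 v
  | fhalf phi1 => eval phi1 v / 2
  | fsubt phi1 phi2 => Num.max (eval phi1 v - eval phi2 v) 0
  | fsup phi1 => sup [set eval phi1 (vcons a v) | a in [set: M]]
  | finf phi1 => inf [set eval phi1 (vcons a v) | a in [set: M]]
  end.

Definition models (T : theory L) : Prop :=
  forall c, T c -> eval c.1 (of_void M) <= c.2.

Definition order_property (m n : nat) (phi : formula L ('I_m + 'I_n)) : Prop :=
  exists2 e : R, 0 < e &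
  exists (a : nat -> 'I_m -> M) (b : nat -> 'I_n -> M),
    forall i j, (i < j)%N ->
      e <= `|eval phi (vsum (a i) (b j)) - eval phi (vsum (a j) (b i))|.

Definition automorphism (s : M -> M) : Prop :=
  [/\ bijective s,
      forall x y, mdist (s x) (s y) = mdist x y,
      forall (f : fsym L) x, s (fint (f := f) x) = fint (f := f) (s \o x) &
      forall (P : psym L) x, pint (P := P) (s \o x) = pint (P := P) x].

End Semantics.

Definition stable (R : realType) (L : language R) (T : theory L) : Prop :=
  forall (N : structure L), models N T ->
  forall m n (phi : formula L ('I_m + 'I_n)), ~ order_property N phi.

(* The type [K] stands for its cardinal, below which sets are small. *)
Definition card_lt (T U : Type) (A : set T) (B : set U) : Prop :=
  (A #<= B)%card /\ ~ (B #<= A)%card.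

Definition small (K T : Type) (A : set T) : Prop := card_lt A [set: K].

Definition strong_limit (K : Type) : Prop :=
  small K [set: nat] /\
  forall X : set K, small K X -> small K [set Y : set K | Y `<=` X].

Section Monster.
Context {R : realType} {L : language R} (K : Type) (M : structure L).

Definition saturated : Prop :=
  forall (C : set M), small K C ->
  forall (m : nat) (S : set (condition L ('I_m + C))),
    (forall (k : nat) (c : 'I_k -> condition L ('I_m + C)) (e : R), 0 < e ->
       (forall i, S (c i)) ->
       exists a : 'I_m -> M,
         forall i, eval (c i).1 (vsum a val) <= (c i).2 + e) ->
    exists a : 'I_m -> M, forall c, S c -> eval c.1 (vsum a val) <= c.2.

Definition strongly_homogeneous : Prop :=
  forall (C : set M), small K C ->
  forall g : C -> M,
    (forall phi : formula L C, eval phi g = eval phi val) ->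
    exists2 s : M -> M, automorphism s & forall c : C, s (val c) = g c.

Definition monster (T : theory L) : Prop :=
  [/\ models M T,
      strong_limit K,
      small K [set: fsym L] /\ small K [set: psym L],
      saturated &
      strongly_homogeneous].

End Monster.

Section Imaginaries.
Context {R : realType} {L : language R} (M : structure L).

Definition definable0 (V : Type) (theta : (V -> M) -> R) : Prop :=
  forall e : R, 0 < e ->
  exists phi : formula L V, forall v, `|theta v - eval phi v| <= e.

(* The sort attached to a predicate theta(x, y) definable without parameters,
   with [|x| = n] and [y] a countable tuple, is the set of all [b] modulo
   sup_x |theta(x, b) - theta(x, b')| = 0. The class of [b] is represented by
   the function [ival] = theta(-, b); the metric of the sort then becomes the
   uniform distance between such functions. *)
Record imaginary (n : nat) := Imaginary {
  isort : ('I_n + nat -> M) -> R;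
  ival : ('I_n -> M) -> R;
  isort_def : definable0 isort;
  ival_inst : exists b : nat -> M, forall x, ival x = isort (vsum x b) }.

Inductive meq : Type :=
| mreal of M
| mimag (n : nat) of imaginary n.

Definition canonical_parameter (n : nat) (psi : ('I_n -> M) -> R) (c : meq) :
    Prop :=
  exists2 d : imaginary n, c = mimag d & ival d = psi.

Definition fixes (s : M -> M) (c : meq) : Prop :=
  match c with
  | mreal a => s a = a
  | mimag n d => forall x, ival d (s \o x) = ival d x
  end.

Definition aut_over (B : set meq) (s : M -> M) : Prop :=
  automorphism s /\ forall b, B b -> fixes s b.

(* [M] is meant to be a monster model and [B] small: the realisations of
   tp(c / B) are then the conjugates of [c] under the automorphisms fixing [B],
   and [c] is definable over [B] if it is the only one. *)
Definition dcleq (B : set meq) : set meq :=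
  [set c | forall s, aut_over B s -> fixes s c].

(* [c] is algebraic over [B] if its orbit over [B], i.e. the set of
   realisations of tp(c / B), is compact in the metric of its sort. *)
Definition acleq (B : set meq) : set meq :=
  [set c | match c with
           | mreal a => compact [set s a | s in aut_over B]
           | mimag n d =>
               compact ([set (fun x => ival d (s \o x)) | s in aut_over B]
                        : set {uniform ('I_n -> M) -> R})
           end].

End Imaginaries.

Section Types.
Context {R : realType} {L : language R} {M : structure L}.

(* A complete m-type over [C] is given by the values it assigns to the formulas
   over [C]; it must be approximately finitely realised in [M]. *)
Record ctype (m : nat) (C : set M) := CType {
  tval :> formula L ('I_m + C) -> R;
  tval_fin : forall (k : nat) (phi : 'I_k -> formula L ('I_m + C)) (e : R),
    0 < e -> exists a : 'I_m -> M,
      forall i, `|tval (phi i) - eval (phi i) (vsum a val)| <= e }.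

Fact tp_fin (m : nat) (a : 'I_m -> M) (C : set M) (k : nat)
    (phi : 'I_k -> formula L ('I_m + C)) (e : R) : 0 < e ->
  exists a' : 'I_m -> M,
    forall i, `|eval (phi i) (vsum a val) - eval (phi i) (vsum a' val)| <= e.
Proof. by move=> /ltW e0; exists a => i; rewrite subrr normr0. Qed.

Definition tp (m : nat) (a : 'I_m -> M) (C : set M) : ctype m C :=
  @CType m C (fun phi => eval phi (vsum a val)) (@tp_fin m a C).

Definition realises (m : nat) (C : set M) (a : 'I_m -> M) (p : ctype m C) :
    Prop := forall phi, eval phi (vsum a val) = p phi.

Definition set_incl (A C : set M) (AC : A `<=` C) (a : A) : C :=
  SigSub (mem_set (AC _ (set_mem (valP a)))).

Definition extends (m : nat) (A C : set M) (AC : A `<=` C)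
    (q : ctype m C) (p : ctype m A) : Prop :=
  forall phi, q (formula_map (vsum inl (inr \o set_incl AC)) phi) = p phi.

Definition instance (m n : nat) (C : set M) (phi : formula L ('I_m + 'I_n))
    (b : 'I_n -> C) : formula L ('I_m + C) :=
  formula_map (vsum inl (inr \o b)) phi.

(* A phi-type over [M], given by the value [psi b] of each instance phi(x, b);
   as a function of [b], [psi] is also the phi-definition of that type. *)
Definition phi_type (m n : nat) (phi : formula L ('I_m + 'I_n))
    (psi : ('I_n -> M) -> R) : Prop :=
  forall (k : nat) (b : 'I_k -> 'I_n -> M) (e : R), 0 < e ->
  exists a : 'I_m -> M, forall i, `|psi (b i) - eval phi (vsum a (b i))| <= e.

(* A definable predicate is over [B] if its canonical parameter is definable
   over [B]. *)
Definition over (n : nat) (B : set (meq M)) (psi : ('I_n -> M) -> R) : Prop :=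
  exists2 c, canonical_parameter psi c & dcleq B c.

Definition nonforking (m : nat) (A C : set M) (q : ctype m C) : Prop :=
  forall (n : nat) (phi : formula L ('I_m + 'I_n)),
  exists psi : ('I_n -> M) -> R,
    [/\ phi_type phi psi,
        forall b : 'I_n -> C, psi (val \o b) = q (instance phi b) &
        over (acleq (@mreal R L M @` A)) psi].

Definition independent (m : nat) (A : set M) (a : 'I_m -> M) (B : set M) :
    Prop := nonforking A (tp a (A `|` B)).

Definition stationary (m : nat) (A : set M) (p : ctype m A) : Prop :=
  forall (C : set M) (AC : A `<=` C),
  exists! q : ctype m C, extends AC q p /\ nonforking A q.

(* The model to which [p] is extended is the monster model itself. *)
Definition Cb (m : nat) (A : set M) (p : ctype m A) : set (meq M) :=
  [set c | exists q : ctype m [set: M],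
     [/\ extends (@subsetT M A) q p, nonforking A q &
         exists (n : nat) (phi : formula L ('I_m + 'I_n))
                (psi : ('I_n -> M) -> R),
           (forall b : 'I_n -> [set: M], psi (val \o b) = q (instance phi b)) /\
           canonical_parameter psi c]].

Definition morley_sequence (m : nat) (A : set M) (p : ctype m A)
    (I : nat -> 'I_m -> M) : Prop :=
  (forall n, realises (I n) p) /\
  (forall n, independent A (I n)
     (\bigcup_(k in [set k | (k < n)%N]) range (I k))).

Definition tail (m : nat) (I : nat -> 'I_m -> M) (k : nat) : set M :=
  \bigcup_(n in [set n | (k <= n)%N]) range (I n).

Definition tdcleq (m : nat) (I : nat -> 'I_m -> M) : set (meq M) :=
  \bigcap_k dcleq (@mreal R L M @` tail I k).

End Types.

(* Main.v *)
Require Import Defs.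
From HB Require Import structures.
From mathcomp Require Import all_boot all_order all_algebra.
From mathcomp Require Import all_classical all_reals all_analysis.
From mathcomp Require Import lra.

(* Let q be the global non-forking extension of p. By uniqueness q is invariant
   under Aut(M/A), each term I n realises q over A and the earlier terms, and
   two such sequences are conjugate over A.
   Stability gives phi(I n, b) --> q(phi(x, b)) for every b: otherwise one
   copies b and I along automorphisms over A into a pattern with the order
   property.
   An automorphism fixing a tail of I therefore fixes the phi-definitions of q,
   so Cb(p) is contained in tdcl(I).
   Conversely let s fix Cb(p), hence q, and let c be in tdcl(I). Up to e, c is
   determined by F = I_{<N0} and also by G = I_{[N0, N1)}. Let G' be a sequence
   of realisations of q over A, s(A), F and s(F). Some automorphism fixes F and
   moves G to G', and another one fixes s(F) and moves s(G) to G'; comparing the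
   images of c at G' shows that s(c) is within 3e of c. *)

Set Implicit Arguments.
Unset Strict Implicit.
Unset Printing Implicit Defensive.

Import Order.TTheory GRing.Theory Num.Theory.
(* [eval] is also a name of MathComp-Analysis. *)
Import Defs.

Local Open Scope classical_set_scope.
Local Open Scope ring_scope.

(** * Small sets and their unions *)

Section Cardinality.

Lemma card_le_injP (T U : Type) (A : set T) (B : set U) :
  (A #<= B)%card <-> exists f : A -> B, injective f.
Proof.
split=> [/card_leP[f]|[f finj]].
  exists f => x y; exact: (@inj _ _ _ f x y (in_setT x) (in_setT y)).
apply/card_leP/injfunPex; exists f => //.
by move=> x y _ _; exact: finj.
Qed.

Context (K : Type).

Lemma small_le (T U : Type) (A : set T) (B : set U) :
  (A #<= B)%card -> small K B -> small K A.
Proof.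
move=> AB [BK KB]; split; first exact: card_le_trans AB BK.
by move=> KA; apply: KB; exact: card_le_trans KA AB.
Qed.

Context (limK : strong_limit K).

Lemma countable_small (T : Type) (A : set T) : countable A -> small K A.
Proof. by move=> Ac; apply: small_le limK.1. Qed.

(* For [A] infinite and of the same size as [X] in [K], the union embeds into
   the powerset of [X] by mapping the points of [A] to singletons and the other
   ones to complements of singletons. *)
Lemma small_setU_le (T : Type) (A B : set T) :
  small K A -> (B #<= A)%card -> small K (A `|` B).
Proof.
move=> Asm BA; have [Afin|Ainf] := pselect (finite_set A).
  apply/countable_small/finite_set_countable; rewrite finite_setU; split => //.
  have [n An] := (finite_set_leP A).1 Afin.
  by apply/finite_set_leP; exists n; exact: card_le_trans BA An.
have [f finj] := (card_le_injP _ _).1 Asm.1.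
have [g ginj] := (card_le_injP _ _).1 BA.
pose F (a : A) : K := val (f a).
have Finj : injective F by move=> x y /val_inj /finj.
pose X := range F.
have Xsm : small K X.
  apply: small_le Asm; apply: card_le_trans (card_image_le F _) _;
  apply/card_le_injP; exists val; exact: val_inj.
have Xinf : infinite_set X.
  move=> Xfin; apply: Ainf; apply/finite_set_leP.
  have [n Xn] := (finite_set_leP X).1 Xfin; exists n.
  apply: card_le_trans Xn; apply/card_le_injP.
  exists (fun a => SigSub (mem_set (imageT F a))) => x y /(congr1 val) /=.
  exact: Finj.
apply: small_le (limK.2 X Xsm); apply/card_le_injP.
have side (u : A `|` B) : exists Y : set K, Y `<=` X /\
    ((exists2 a : A, val a = val u & Y = [set F a]) \/
     (exists2 b : B, val b = val u & Y = X `\ F (g b))).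
  case: u => u /= /set_mem [Au|Bu].
    exists [set F (SigSub (mem_set Au))]; split.
      by move=> _ ->; exact: imageT.
    by left; exists (SigSub (mem_set Au)).
  exists (X `\ F (g (SigSub (mem_set Bu)))); split.
    exact: subDsetl.
  by right; exists (SigSub (mem_set Bu)).
pose Y u := sval (cid (side u)).
have YX u : [set Z | Z `<=` X] (Y u) := (svalP (cid (side u))).1.
have YP u : (exists2 a : A, val a = val u & Y u = [set F a]) \/
    (exists2 b : B, val b = val u & Y u = X `\ F (g b)).
  exact: (svalP (cid (side u))).2.
(* As [X] is infinite, the images of the two kinds never coincide, so points with equal images are
   of the same kind. *)
have single_cosingle x y : [set x] <> X `\ y.
  move=> E; apply: Xinf; apply: (@sub_finite_set _ _ [set x; y]) => //.
  move=> z Xz; have [->|zy] := pselect (z = y); first by right.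
  by left; rewrite E; split.
exists (fun u => SigSub (mem_set (YX u))) => u v /(congr1 val) /= YE.
apply: val_inj.
have [[a <- aE]|[b <- bE]] := YP u; have [[a' <- a'E]|[b' <- b'E]] := YP v.
- by congr val; apply: Finj; have : [set F a] (F a) by []; rewrite -aE YE a'E.
- by have := @single_cosingle (F a) (F (g b')); rewrite -aE -b'E YE.
- by have := @single_cosingle (F a') (F (g b)); rewrite -bE -a'E YE.
- congr val; apply: ginj; apply: Finj.
  have : ~ (X `\ F (g b)) (F (g b)) by move=> [_]; apply.
  rewrite -bE YE b'E => h; apply: contrapT => ne; apply: h; split => //.
  exact: imageT.
Qed.

Lemma small_setU_finite (T : Type) (A B : set T) :
  small K A -> finite_set B -> small K (A `|` B).
Proof.
move=> Asm Bfin; have [Afin|/infiniteP Ainf] := pselect (finite_set A).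
  by apply/countable_small/finite_set_countable; rewrite finite_setU.
apply: small_setU_le => //; apply: card_le_trans Ainf.
exact: finite_set_countable.
Qed.

End Cardinality.

(** * Renaming of variables, finite supports, and automorphisms *)

Section Syntax.
Context {R : realType} {L : language R}.

Lemma term_map_comp (U V W : Type) (f : V -> W) (g : U -> V) (t : term L U) :
  term_map f (term_map g t) = term_map (f \o g) t.
Proof. by elim: t => //= h ts IH; congr tapp; apply/funext. Qed.

Lemma formula_map_comp (U V W : Type) (f : V -> W) (g : U -> V)
    (phi : formula L U) :
  formula_map f (formula_map g phi) = formula_map (f \o g) phi.
Proof.
have opt (U1 V1 W1 : Type) (f1 : V1 -> W1) (g1 : U1 -> V1) :
    option_map f1 \o option_map g1 = option_map (f1 \o g1).
  by apply/funext; case.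
elim: phi V W f g => {U} /=.
- by move=> U s t V W f g; rewrite !term_map_comp.
- by move=> U P ts V W f g; congr fpred; apply/funext => i;
  rewrite term_map_comp.
- by move=> U phi IH V W f g; rewrite IH.
- by move=> U phi IH V W f g; rewrite IH.
- by move=> U phi IH psi IH' V W f g; rewrite IH IH'.
- by move=> U phi IH V W f g; rewrite IH opt.
- by move=> U phi IH V W f g; rewrite IH opt.
Qed.

Lemma term_map_id (V : Type) (t : term L V) : term_map id t = t.
Proof. by elim: t => //= h ts IH; congr tapp; apply/funext. Qed.

Lemma formula_map_id (V : Type) (phi : formula L V) : formula_map id phi = phi.
Proof.
have opt (V1 : Type) : option_map (@id V1) = id by apply/funext; case.
elim: phi => {V} /=.
- by move=> V s t; rewrite !term_map_id.
- by move=> V P ts; congr fpred; apply/funext => i; rewrite term_map_id.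
- by move=> V phi ->.
- by move=> V phi ->.
- by move=> V phi -> psi ->.
- by move=> V phi IH; rewrite opt IH.
- by move=> V phi IH; rewrite opt IH.
Qed.

(** Pools the supports of the arguments of a symbol into one tuple, indexed by the disjoint union of
    their index types. *)
Lemma finite_support_merge (V : Type) (k : nat) (n : 'I_k -> nat)
    (b : forall i, 'I_(n i) -> V) :
  exists (N : nat) (c : 'I_N -> V) (h : forall i, 'I_(n i) -> 'I_N),
    forall i, b i = c \o h i.
Proof.
pose W := {i : 'I_k & 'I_(n i)}.
exists #|{: W}|, (fun x => let w : W := enum_val x in b (tag w) (tagged w)).
exists (fun i j => enum_rank (Tagged (fun i => 'I_(n i)) j)) => i.
by apply/funext => j /=; rewrite enum_rankK.
Qed.

Lemma term_finite_support (V : Type) (t : term L V) :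
  exists (n : nat) (b : 'I_n -> V) (t0 : term L 'I_n), t = term_map b t0.
Proof.
elim: t => [x|f ts IH].
  by exists 1%N, (fun=> x), (tvar L ord0).
pose n i := sval (cid (IH i)).
pose b i := sval (cid (svalP (cid (IH i)))).
pose t0 i := sval (cid (svalP (cid (svalP (cid (IH i)))))).
have tsE i : ts i = term_map (b i) (t0 i).
  exact: (svalP (cid (svalP (cid (svalP (cid (IH i))))))).
have [N [c [h bE]]] := finite_support_merge b.
exists N, c, (tapp (fun i => term_map (h i) (t0 i))) => /=.
by congr tapp; apply/funext => i; rewrite term_map_comp -bE.
Qed.

(* An index [b i = None] denotes the bound variable and must be dropped; when
   [V] is empty there is no other kind of index, otherwise a dummy value of [V]
   takes its place. *)
Lemma unbind_support (V : Type) (n : nat) (b : 'I_n -> option V) :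
  exists (n' : nat) (b' : 'I_n' -> V) (h : 'I_n -> option 'I_n'),
    b = option_map b' \o h.
Proof.
have [[v0]|V0] := pselect (inhabited V).
  exists n, (fun i => odflt v0 (b i)),
    (fun i => if b i is Some _ then Some i else None).
  by apply/funext => i /=; case bi: (b i) => [v|] //=; rewrite bi.
have b' : 'I_0 -> V by case.
exists 0%N, b', (fun=> None).
by apply/funext => i /=; case: (b i) => // v; case: V0; exists.
Qed.

(** Types and saturation allow any set of parameters, whereas definitions of types use finite
    tuples; this links the two settings. *)
Lemma formula_finite_support (V : Type) (phi : formula L V) :
  exists (n : nat) (b : 'I_n -> V) (phi0 : formula L 'I_n),
    phi = formula_map b phi0.
Proof.
have merge2 (U : Type) n1 n2 (b1 : 'I_n1 -> U) (b2 : 'I_n2 -> U) :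
    exists (N : nat) (c : 'I_N -> U) (h1 : 'I_n1 -> 'I_N) (h2 : 'I_n2 -> 'I_N),
      b1 = c \o h1 /\ b2 = c \o h2.
  exists (n1 + n2)%N, (fun i => vsum b1 b2 (fintype.split i)),
    (@lshift n1 n2), (@rshift n1 n2); split; apply/funext => i /=.
    by rewrite (unsplitK (inl i)).
  by rewrite (unsplitK (inr i)).
elim: phi => {V}.
- move=> V s t; have [n1 [b1 [s0 ->]]] := term_finite_support s.
  have [n2 [b2 [t0 ->]]] := term_finite_support t.
  have [N [c [h1 [h2 [-> ->]]]]] := merge2 _ _ _ b1 b2.
  exists N, c, (fdist (term_map h1 s0) (term_map h2 t0)).
  by rewrite /= !term_map_comp.
- move=> V P ts; pose H i := term_finite_support (ts i).
  pose n i := sval (cid (H i)).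
  pose b i := sval (cid (svalP (cid (H i)))).
  pose t0 i := sval (cid (svalP (cid (svalP (cid (H i)))))).
  have tsE i : ts i = term_map (b i) (t0 i).
    exact: (svalP (cid (svalP (cid (svalP (cid (H i))))))).
  have [N [c [h bE]]] := finite_support_merge b.
  exists N, c, (fpred (fun i => term_map (h i) (t0 i))) => /=.
  by congr fpred; apply/funext => i; rewrite term_map_comp -bE.
- by move=> V phi [n [b [phi0 ->]]]; exists n, b, (fneg phi0).
- by move=> V phi [n [b [phi0 ->]]]; exists n, b, (fhalf phi0).
- move=> V phi [n1 [b1 [s0 ->]]] psi [n2 [b2 [t0 ->]]].
  have [N [c [h1 [h2 [-> ->]]]]] := merge2 _ _ _ b1 b2.
  exists N, c, (fsubt (formula_map h1 s0) (formula_map h2 t0)).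
  by rewrite /= !formula_map_comp.
- move=> V phi [n [b [phi0 ->]]].
  have [n' [b' [h ->]]] := unbind_support b.
  by exists n', b', (fsup (formula_map h phi0)); rewrite /= formula_map_comp.
- move=> V phi [n [b [phi0 ->]]].
  have [n' [b' [h ->]]] := unbind_support b.
  by exists n', b', (finf (formula_map h phi0)); rewrite /= formula_map_comp.
Qed.

Lemma formula_finite_params (U C : Type) (phi : formula L (U + C)) :
  exists (n : nat) (b : 'I_n -> C) (phi0 : formula L (U + 'I_n)),
    phi = formula_map (vsum inl (inr \o b)) phi0.
Proof.
have [n [b [phi0 ->]]] := formula_finite_support phi.
have [[c0]|C0] := pselect (inhabited C).
  (* An index whose variable lies in [U] gets the dummy parameter [c0], which the renamed formula
     does not mention. *)
  exists n, (fun i => if b i is inr c then c else c0),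
    (formula_map (fun i => if b i is inl u then inl u else inr i) phi0).
  rewrite formula_map_comp; congr formula_map; apply/funext => i /=.
  by case bi: (b i) => [u|c] //=; rewrite bi.
have toU x : exists u : U, x = inl u :> U + C.
  by case: x => [u|c]; [exists u | case: C0; exists].
have b' : 'I_0 -> C by case.
exists 0%N, b',
  (formula_map (fun i => inl (sval (cid (toU (b i))))) phi0).
rewrite formula_map_comp; congr formula_map; apply/funext => i /=.
exact: (svalP (cid (toU (b i)))).
Qed.

Context {M : structure L}.
Implicit Types s t : M -> M.

Lemma teval_map (V W : Type) (g : V -> W) (t : term L V) (v : W -> M) :
  teval (term_map g t) v = teval t (v \o g).
Proof. by elim: t => //= f ts IH; congr fint; apply/funext. Qed.

Lemma eval_map (V W : Type) (g : V -> W) (phi : formula L V) (v : W -> M) :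
  eval (formula_map g phi) v = eval phi (v \o g).
Proof.
have vconsE (V1 W1 : Type) (g1 : V1 -> W1) (v1 : W1 -> M) a :
    vcons a v1 \o option_map g1 = vcons a (v1 \o g1).
  by apply/funext; case.
elim: phi W g v => {V} /=.
- by move=> V s t W g v; rewrite !teval_map.
- by move=> V P ts W g v; congr pint; apply/funext => i; rewrite teval_map.
- by move=> V phi IH W g v; rewrite IH.
- by move=> V phi IH W g v; rewrite IH.
- by move=> V phi IH psi IH' W g v; rewrite IH IH'.
- by move=> V phi IH W g v; congr sup; apply: eq_imagel => a _;
  rewrite IH vconsE.
- by move=> V phi IH W g v; congr inf; apply: eq_imagel => a _;
  rewrite IH vconsE.
Qed.

Lemma automorphism_inv s : automorphism s ->
  exists2 t, automorphism t & cancel s t /\ cancel t s.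
Proof.
move=> [[t st ts] sd sf sp]; exists t => //; split.
- by exists s.
- by move=> x y; rewrite -sd !ts.
- move=> f x; rewrite -[RHS]st sf; congr (t (fint _)).
  by apply/funext => i /=; rewrite ts.
- move=> P x; rewrite -sp; congr pint.
  by apply/funext => i /=; rewrite ts.
Qed.

Lemma automorphism_comp s t :
  automorphism s -> automorphism t -> automorphism (s \o t).
Proof.
move=> [sb sd sf sp] [tb td tf tp]; split.
- exact: bij_comp.
- by move=> x y /=; rewrite sd td.
- by move=> f x /=; rewrite tf sf.
- by move=> P x; rewrite -compA sp tp.
Qed.

Lemma automorphism_id : automorphism (@id M).
Proof. by split => //; exists id. Qed.

Lemma teval_automorphism s (V : Type) (t : term L V) (v : V -> M) :
  automorphism s -> teval t (s \o v) = s (teval t v).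
Proof.
move=> [_ _ sf _]; elim: t => //= f ts IH; rewrite sf; congr fint.
exact/funext.
Qed.

Lemma eval_automorphism s (V : Type) (phi : formula L V) (v : V -> M) :
  automorphism s -> eval phi (s \o v) = eval phi v.
Proof.
move=> sA; have [[t st ts] sd _ sp] := sA.
have vconsE (V1 : Type) (v1 : V1 -> M) a :
    vcons (s a) (s \o v1) = s \o vcons a v1.
  by apply/funext; case.
(* For the quantifiers: as [s] is onto, moving the free variables by [s] leaves the set of values
   unchanged. *)
have imE (V1 : Type) (v1 : V1 -> M) (F : (option V1 -> M) -> R) :
    (forall w, F (s \o w) = F w) ->
    [set F (vcons a (s \o v1)) | a in [set: M]] =
    [set F (vcons a v1) | a in [set: M]].
  move=> Fs; apply/seteqP; split => _ [a _ <-].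
    by exists (t a) => //; rewrite -Fs -vconsE ts.
  by exists (s a) => //; rewrite vconsE Fs.
elim: phi v => {V} /=.
- by move=> V t1 t2 v; rewrite !teval_automorphism.
- move=> V P ts0 v; rewrite -[RHS]sp; congr pint.
  by apply/funext => i /=; rewrite teval_automorphism.
- by move=> V phi IH v; rewrite IH.
- by move=> V phi IH v; rewrite IH.
- by move=> V phi IH psi IH' v; rewrite IH IH'.
- by move=> V phi IH v; rewrite imE.
- by move=> V phi IH v; rewrite imE.
Qed.

Lemma eval_itv (V : Type) (phi : formula L V) (v : V -> M) :
  0 <= eval phi v <= 1.
Proof.
have [a0] := car_inh M.
elim: phi v => {V} /=.
- by move=> V s t v; rewrite mdist_ge0 car_diam.
- by move=> V P ts v; exact: pint_range.
- by move=> V phi IH v; have /andP[h0 h1] := IH v; apply/andP; split; lra.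
- by move=> V phi IH v; have /andP[h0 h1] := IH v; apply/andP; split; lra.
- move=> V phi IH psi IH' v.
  have /andP[h0 h1] := IH v; have /andP[h0' h1'] := IH' v.
  by rewrite le_max lexx orbT ge_max ler01 andbT /=; lra.
- move=> V phi IH v; set S := (X in sup X); apply/andP; split.
    have /andP[h0 _] := IH (vcons a0 v).
    apply: le_trans h0 _; apply: ub_le_sup; last by exists a0.
    by exists 1 => _ [a _ <-]; have /andP[] := IH (vcons a v).
  apply: ge_sup; first by exists (eval phi (vcons a0 v)), a0.
  by move=> _ [a _ <-]; have /andP[] := IH (vcons a v).
- move=> V phi IH v; set S := (X in inf X); apply/andP; split.
    apply: lb_le_inf; first by exists (eval phi (vcons a0 v)), a0.
    by move=> _ [a _ <-]; have /andP[] := IH (vcons a v).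
  have /andP[_ h1] := IH (vcons a0 v).
  apply: le_trans h1; apply: ge_inf; last by exists a0.
  by exists 0 => _ [a _ <-]; have /andP[] := IH (vcons a v).
Qed.

End Syntax.

(** * Saturation and homogeneity for indexed families *)

Section Families.
Context {R : realType} {L : language R} {K : Type} {M : structure L}.

(** Parameters may be listed with repetitions and variables by any finite type, so that several
    tuples can be handled side by side through sums of index types. *)
Lemma saturated_family (U : finType) (V : Type) (e : V -> M)
    (S : set (condition L (U + V))) :
  saturated K M -> small K (range e) ->
  (forall (k : nat) (c : 'I_k -> condition L (U + V)) (eps : R), 0 < eps ->
     (forall i, S (c i)) ->
     exists a : U -> M, forall i, eval (c i).1 (vsum a e) <= (c i).2 + eps) ->
  exists a : U -> M, forall c, S c -> eval c.1 (vsum a e) <= c.2.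
Proof.
move=> sat esm Sfin.
pose io v : range e := SigSub (mem_set (imageT e v)).
pose r : U + V -> 'I_#|U| + range e := vsum (inl \o enum_rank) (inr \o io).
have rE phi (a : 'I_#|U| -> M) :
    eval (formula_map r phi) (vsum a val) = eval phi (vsum (a \o enum_rank) e).
  by rewrite eval_map; congr eval; apply/funext; case.
pose F (c : condition L (U + V)) := (formula_map r c.1, c.2).
have [|a aP] := sat _ esm _ (F @` S).
  move=> k c eps eps0 Sc.
  have [|a aP] := Sfin k (fun i => sval (cid2 (Sc i))) eps eps0.
    by move=> i; case: cid2.
  exists (a \o enum_val) => i; have := aP i; case: cid2 => d /= _ <- /=.
  rewrite rE; congr (eval _ (vsum _ _) <= _).
  by apply/funext => u /=; rewrite enum_rankK.
by exists (a \o enum_rank) => c Sc; have := aP _ (imageP F Sc); rewrite rE.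
Qed.

Lemma homogeneous_family (V : Type) (e e' : V -> M) :
  strongly_homogeneous K M -> small K (range e) ->
  (forall phi : formula L V, eval phi e = eval phi e') ->
  exists2 s : M -> M, automorphism s & forall v, s (e v) = e' v.
Proof.
move=> hom esm ee'.
pose r (c : range e) : V := sval (cid2 (set_mem (valP c))).
have rE c : e (r c) = val c by rewrite /r; case: cid2.
have [|s sA sE] := hom _ esm (e' \o r).
  move=> phi; rewrite -eval_map -ee' eval_map; congr eval.
  exact/funext.
exists s => // v; pose c : range e := SigSub (mem_set (imageT e v)).
(* The index chosen for the point [e v] may differ from [v]; the distance formula at the two indices
   is 0 under [e], hence also under [e']. *)
rewrite -[e v]/(val c) sE /=; apply: mdist_positivity.
have := ee' (fdist (tvar L (r c)) (tvar L v)).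
by rewrite /= rE mdistxx => <-.
Qed.

End Families.

(** * Realisations of restrictions of a global type *)

Section Generic.
Context {R : realType} {L : language R} {K : Type} {M : structure L}.
Context {m : nat} (q : ctype m [set: M]).
Implicit Types (s : M -> M) (a : 'I_m -> M) (A C D : set M).

Definition gparam (x : M) : [set: M] := SigSub (mem_set (Logic.I : setT x)).

(* [gvalue phi v] is the value of phi(x, v) in [q], i.e. the phi-definition of
   [q] at [v]. *)
Definition gvalue (V : Type) (phi : formula L ('I_m + V)) (v : V -> M) : R :=
  q (formula_map (vsum inl (inr \o gparam \o v)) phi).

Definition generic a C := forall phi : formula L ('I_m + C),
  eval phi (vsum a val) = gvalue phi val.

(** Morley sequences of the global type [q] over [C], expressed by values of [q] instead of forking,
    so that automorphisms preserving [q] act on them. *)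
Definition gseq C (a : nat -> 'I_m -> M) := forall n,
  generic (a n) (C `|` \bigcup_(k in [set k | (k < n)%N]) range (a k)).

Definition ginvariant s := forall phi : formula L ('I_m + M),
  gvalue phi s = gvalue phi id.

Lemma gvalue_map (V W : Type) (g : V -> W) (phi : formula L ('I_m + V))
    (v : W -> M) :
  gvalue (formula_map (vsum inl (inr \o g)) phi) v = gvalue phi (v \o g).
Proof.
rewrite /gvalue formula_map_comp; congr (tval q (formula_map _ _)).
by apply/funext; case.
Qed.

Lemma eval_vsum_map (V W : Type) (g : V -> W) (phi : formula L ('I_m + V)) a
    (v : W -> M) :
  eval (formula_map (vsum inl (inr \o g)) phi) (vsum a v) =
  eval phi (vsum a (v \o g)).
Proof. by rewrite eval_map; congr eval; apply/funext; case. Qed.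

Lemma generic_eval a C (V : Type) (phi : formula L ('I_m + V)) (v : V -> M) :
  generic a C -> (forall i, C (v i)) -> eval phi (vsum a v) = gvalue phi v.
Proof.
move=> aC vC; pose r i : C := SigSub (mem_set (vC i)).
by have := aC (formula_map (vsum inl (inr \o r)) phi);
  rewrite eval_vsum_map gvalue_map.
Qed.

Lemma generic_sub a C D : D `<=` C -> generic a C -> generic a D.
Proof.
move=> DC aC phi; apply: generic_eval aC _ => d.
exact/DC/set_mem/valP.
Qed.

Lemma generic_ex C : saturated K M -> small K C -> exists a, generic a C.
Proof.
move=> sat Csm.
(* Conditions are upper bounds only; the one on the negation gives the reverse inequality. *)
pose S : set (condition L ('I_m + C)) := [set c | exists phi,
  c = (phi, gvalue phi val) \/ c = (fneg phi, 1 - gvalue phi val)].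
have [|a aP] := sat _ Csm _ S.
  move=> k c eps eps0 Sc.
  pose phi i := sval (cid (Sc i)).
  have [a aP] := tval_fin q
    (fun i => formula_map (vsum inl (inr \o gparam \o val)) (phi i)) eps0.
  have evalE (psi : formula L ('I_m + C)) :
      eval (formula_map (vsum inl (inr \o gparam \o val)) psi) (vsum a val) =
      eval psi (vsum a val).
    exact: eval_vsum_map.
  exists a => i; have := aP i; rewrite evalE -/(gvalue (phi i) val).
  rewrite /phi; case: cid => psi /= cE; rewrite ler_norml => /andP[h1 h2].
  by case: cE => ->; rewrite /=; lra.
exists a => phi; apply/eqP; rewrite eq_le; apply/andP; split.
  by have := aP (phi, gvalue phi val); apply; exists phi; left.
have /= := aP (fneg phi, 1 - gvalue phi val).
by rewrite lerD2l lerN2; apply; exists phi; right.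
Qed.

Lemma ginvariantE s (V : Type) (phi : formula L ('I_m + V)) (v : V -> M) :
  ginvariant s -> gvalue phi (s \o v) = gvalue phi v.
Proof.
by move=> /(_ (formula_map (vsum inl (inr \o v)) phi)); rewrite !gvalue_map.
Qed.

Lemma ginvariantV s t : cancel t s -> ginvariant s -> ginvariant t.
Proof.
move=> ts sq phi; rewrite -(ginvariantE _ _ sq); congr gvalue.
by apply/funext => x /=; rewrite ts.
Qed.

Lemma generic_image s a C : automorphism s -> ginvariant s ->
  generic a C -> generic (s \o a) (s @` C).
Proof.
move=> sA sq aC phi; have [t tA [st ts]] := automorphism_inv sA.
have valE : (val : s @` C -> M) = s \o (t \o val).
  by apply/funext => c /=; rewrite ts.
rewrite valE ginvariantE // -(generic_eval _ aC); last first.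
  by move=> [_ /= /set_mem[c Cc <-]]; rewrite st.
rewrite -[RHS](eval_automorphism _ _ sA); congr eval.
by apply/funext; case.
Qed.

Lemma generic_conj C a a' : strong_limit K -> strongly_homogeneous K M ->
  small K C -> generic a C -> generic a' C ->
  exists s, [/\ automorphism s, forall x, C x -> s x = x & s \o a = a'].
Proof.
move=> limK hom Csm aC a'C.
have Casm : small K (C `|` range a).
  by apply: small_setU_finite => //; exact/finite_image/finite_finset.
have [||s sA sE] := @homogeneous_family _ _ _ _ ('I_m + C) (vsum a val)
    (vsum a' val) hom.
- apply: small_le Casm; apply: subset_card_le => _ [[i|c] _ <-] /=;
    last by left; exact/set_mem/valP.
  by right; exists i.
- by move=> phi; rewrite aC a'C.
exists s; split => // [x Cx|].
  exact: (sE (inr (SigSub (mem_set Cx)))).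
by apply/funext => i; exact: (sE (inl i)).
Qed.

End Generic.

(** * Morley sequences of an invariant global type *)

Section GenericSequences.
Context {R : realType} {L : language R} {K : Type} {M : structure L}.
Context {m : nat} (q : ctype m [set: M]) (A : set M).
Context (limK : strong_limit K) (sat : saturated K M)
  (hom : strongly_homogeneous K M).
Context (Asm : small K A)
  (Ainv : forall s : M -> M, automorphism s -> (forall x, A x -> s x = x) ->
    ginvariant q s).
Implicit Types (s : M -> M) (a : nat -> 'I_m -> M) (C : set M).

Let finite_segment a n :
  finite_set (\bigcup_(k in [set k | (k < n)%N]) range (a k)).
Proof.
apply: bigcup_finite => [|k _]; first exact: finite_II.
exact/finite_image/finite_finset.
Qed.

Lemma gseq_ex C : small K C -> exists a, gseq q C a.
Proof.
move=> Csm.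
(* The choice function must be total; on sets that are not small its value is an arbitrary constant
   tuple. *)
have /choice[f fP] (D : set M) : exists a : 'I_m -> M,
    small K D -> generic q a D.
  have [Dsm|nDsm] := pselect (small K D).
    by have [a aD] := generic_ex q sat Dsm; exists a.
  by have [x] := car_inh M; exists (fun=> x).
pose S n := iter n (fun D => D `|` range (f D)) C.
have Ssm n : small K (S n).
  elim: n => //= n IH; apply: small_setU_finite => //.
  exact/finite_image/finite_finset.
have Smono i j : (i <= j)%N -> S i `<=` S j.
  elim: j => [|j IH]; first by rewrite leqn0 => /eqP ->.
  by rewrite leq_eqVlt => /predU1P[->//|/IH] /= h x /h; left.
exists (fun n => f (S n)) => n; apply: generic_sub (fP _ (Ssm n)).
move=> x [Cx|[k /= kn fx]]; first exact: (@Smono 0%N).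
by apply: (@Smono k.+1) => //=; right.
Qed.

(* Back-and-forth step: the first [k] terms have already been moved by [s]; the
   next one can be sent to any point realising [q] over the images. *)
Lemma gseq_step a s C k b : gseq q C a -> small K C ->
  automorphism s -> ginvariant q s ->
  generic q b (s @` (C `|` \bigcup_(i in [set i | (i < k)%N]) range (a i))) ->
  exists s', [/\ automorphism s', forall x, C x -> s' x = s x,
    forall i, (i < k)%N -> s' \o a i = s \o a i & s' \o a k = b].
Proof.
move=> aC Csm sA sq bC; have [t tA [st ts]] := automorphism_inv sA.
set D := C `|` _ in bC.
have Dsm : small K D by exact: small_setU_finite.
(* By invariance the preimage of [b] under [s] realises [q] over [D], as [a k] does. Some [u] fixing
   [D] moves [a k] to this preimage, and [s \o u] is the required map. *)
have tbD : generic q (t \o b) D.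
  have := generic_image tA (ginvariantV ts sq) bC; apply: generic_sub.
  by move=> x Dx; exists (s x); [exact: imageP|rewrite st].
have [u [uA uD ua]] := generic_conj limK hom Dsm (aC k) tbD.
exists (s \o u); split.
- exact: automorphism_comp.
- by move=> x Cx /=; rewrite uD//; left.
- move=> i ik; apply/funext => j /=; rewrite uD//; right.
  by exists i => //; exists j.
- by apply/funext => j; rewrite -[LHS]/(s ((u \o a k) j)) ua /= ts.
Qed.

(** Iterates the back-and-forth step, the maps being over [A] and hence preserving [q]. Initial
    segments suffice later, since elements of the tail closure are determined up to an error by
    finitely many terms. *)
Lemma gseq_conj a a' C k : A `<=` C -> small K C ->
  gseq q C a -> gseq q C a' ->
  exists s, [/\ automorphism s, forall x, C x -> s x = x &
    forall i, (i < k)%N -> s \o a i = a' i].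
Proof.
move=> AC Csm aC a'C; elim: k => [|k [s [sA sC sa]]].
  by exists id; split => //; exact: automorphism_id.
have [||s' [s'A s'C s'a s'ak]] := gseq_step (k := k) (b := a' k) aC Csm sA.
- by apply: Ainv => // x Ax; exact/sC/AC.
- apply: generic_sub (a'C k) => _ [x [Cx|[i /= ik [j _ <-]]] <-].
    by left; rewrite sC.
  by right; exists i => //; exists j => //; rewrite -sa.
exists s'; split => // [x Cx|i]; first by rewrite s'C// sC.
rewrite ltnS leq_eqVlt => /predU1P[->//|ik].
by rewrite s'a// sa.
Qed.

Lemma gseq_image a s C : automorphism s -> ginvariant q s -> gseq q C a ->
  gseq q (s @` C) (fun n => s \o a n).
Proof.
move=> sA sq aC n; apply: generic_sub (generic_image sA sq (aC n)).
move=> _ [[x Cx <-]|[k /= kn [j _ <-]]]; first by exists x => //; left.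
by exists (a k j) => //; right; exists k => //; exists j.
Qed.

(** The first [N] terms of [a] lie in [D], over which the terms of [g] already realise [q]. *)
Lemma gseq_splice a g C D N : gseq q C a -> gseq q D g ->
  C `|` \bigcup_(k in [set k | (k < N)%N]) range (a k) `<=` D ->
  gseq q C (fun n => if (n < N)%N then a n else g (n - N)%N).
Proof.
move=> aC gD CD n /=; case: ltnP => [nN|Nn].
  apply: generic_sub (aC n) => x [Cx|[k /= kn]]; first by left.
  by rewrite (ltn_trans kn nN) => xa; right; exists k.
apply: generic_sub (gD (n - N)%N) => x [Cx|[k /= kn]].
  by left; apply: CD; left.
case: ltnP => [kN xa|Nk xg]; first by left; apply: CD; right; exists k.
by right; exists (k - N)%N => //=; rewrite ltn_sub2r// (leq_ltn_trans Nk).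
Qed.

(* The values phi(a i, b) are copied to pairs (a' i, b' j) with i < j, while for
   i > j the tuple a' i is chosen to realise [q] over b' j. *)
Lemma gseq_order_property a n (phi : formula L ('I_m + 'I_n)) (b : 'I_n -> M)
    (e : R) : gseq q A a -> 0 < e ->
  (forall i, e <= `|eval phi (vsum (a i) b) - gvalue q phi b|) ->
  order_property M phi.
Proof.
move=> aA e0 ab.
pose state := ((M -> M) * set M)%type.
(* A state is an automorphism over [A] together with a small set collecting the images produced so
   far. *)
pose P (k : nat) (st : state) := [/\ automorphism st.1,
  forall x, A x -> st.1 x = x, small K st.2, A `<=` st.2 &
  forall i, (i < k)%N -> range (st.1 \o a i) `<=` st.2].
pose Q (k : nat) (st st' : state) := [/\ P k.+1 st',
  forall i, (i < k)%N -> st'.1 \o a i = st.1 \o a i,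
  generic q (st'.1 \o a k) st.2, st.2 `<=` st'.2 &
  range (st'.1 \o b) `<=` st'.2].
have /choice[nxt nxtP] (x : nat * state) :
    exists st', P x.1 x.2 -> Q x.1 x.2 st'.
  have [Px|nPx] := pselect (P x.1 x.2); last by exists x.2.
  case: x Px => k [s S] /= [/= sA sA1 Ssm AS aS].
  (* The next automorphism keeps the images of the earlier terms and sends [a k] to a tuple generic
     over everything collected; this tuple and the new image of [b] are then added. *)
  have [c cS] := generic_ex q sat Ssm.
  have [|s' [s'A s'A1 s'a s'ak]] :=
      gseq_step (k := k) (b := c) aA Asm sA (Ainv sA sA1).
    apply: generic_sub cS => _ [x [Ax|[i /= ik [j _ <-]]] <-].
      by rewrite sA1//; exact: AS.
    by apply: aS ik _ _; exists j.
  exists (s', (S `|` range c) `|` range (s' \o b)) => _.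
  split; [split| exact: s'a | rewrite s'ak // | by move=> x Sx; left; left |
    by move=> x; right] => //=.
  - by move=> x Ax; rewrite s'A1// sA1.
  - apply: small_setU_finite => //; last exact/finite_image/finite_finset.
    by apply: small_setU_finite => //; exact/finite_image/finite_finset.
  - by move=> x Ax; left; left; exact: AS.
  - move=> i; rewrite ltnS leq_eqVlt => /predU1P[->|ik].
      by move=> _ [j _ <-]; left; right; exists j => //; rewrite -s'ak.
    move=> _ [j _ <-]; left; left; apply: (aS i ik); exists j => //.
    by have /(congr1 (@^~ j)) := s'a i ik.
pose st := fix st k := if k is k'.+1 then nxt (k', st k') else (id, A).
have Pst k : P k (st k).
  elim: k => [|k /(nxtP (k, _))[]//].
  by split => //=; exact: automorphism_id.
have Qst k : Q k (st k) (st k.+1) by exact: nxtP (k, _) (Pst k).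
pose rho k := (st k).1; pose S k := (st k).2.
have Smono i j : (i <= j)%N -> S i `<=` S j.
  elim: j => [|j IH]; first by rewrite leqn0 => /eqP ->.
  rewrite leq_eqVlt => /predU1P[->//|/IH] h x /h.
  by have [_ _ _] := Qst j; rewrite /S => + _; apply.
have rhoE i j : (i < j)%N -> rho j \o a i = rho i.+1 \o a i.
  elim: j => // j IH; rewrite ltnS leq_eqVlt => /predU1P[->//|ij].
  by have [_ h _ _ _] := Qst j; rewrite -IH//; exact: h.
have evalE k i : eval phi (vsum (rho k \o a i) (rho k \o b)) =
                 eval phi (vsum (a i) b).
  have [kA _ _ _ _] := Pst k; rewrite -[RHS](eval_automorphism _ _ kA).
  by congr eval; apply/funext; case.
(* For i < j, [rho j.+1] and [rho i.+1] agree on [a i], so the first value is phi(a i, b). The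
   second is the value of [q] at the i-th copy of [b], hence at [b] itself, because the j-th tuple
   is generic over that copy. *)
exists e => //; exists (fun i => rho i.+1 \o a i), (fun j => rho j.+1 \o b).
move=> i j ij; rewrite -(@rhoE i j.+1) ?ltnS 1?ltnW// evalE.
have [_ _ gj _ _] := Qst j.
rewrite (generic_eval _ gj); last first.
  move=> x; have [_ _ _ _ bS] := Qst i.
  by apply: (@Smono i.+1 j) => //; apply: bS; exists x.
rewrite ginvariantE //.
by have [iA iA1 _ _ _] := Pst i.+1; exact: Ainv.
Qed.

(** Otherwise the bad indices contain a subsequence, which is again a Morley sequence and yields the
    order property. *)
Lemma gseq_cvg a n (phi : formula L ('I_m + 'I_n)) (b : 'I_n -> M) (e : R) :
  gseq q A a -> 0 < e -> ~ order_property M phi ->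
  exists N, forall i, (N <= i)%N ->
    `|eval phi (vsum (a i) b) - gvalue q phi b| < e.
Proof.
move=> aA e0 nop; apply: contrapT => bad; apply: nop.
have /choice[f fP] N : exists i, (N <= i)%N /\
    e <= `|eval phi (vsum (a i) b) - gvalue q phi b|.
  apply: contrapT => h; apply: bad; exists N => i Ni.
  by rewrite ltNge; apply/negP => ei; apply: h; exists i.
pose u := fix u k := if k is k'.+1 then f (u k').+1 else f 0%N.
have uS : {homo u : i j / (i < j)%N}.
  by apply: homo_ltn => [y x z|k]; [exact: ltn_trans|exact: (fP (u k).+1).1].
apply: (@gseq_order_property (a \o u) n phi b e) => //.
  move=> k; apply: generic_sub (aA (u k)) => x [Ax|[i /= ik xa]]; first by left.
  by right; exists (u i) => //=; exact: uS.
by case=> [|k]; [exact: (fP 0%N).2|exact: (fP (u k).+1).2].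
Qed.

End GenericSequences.

(** * Action of automorphisms on imaginaries and on algebraic closure *)

Section Imaginaries.
Context {R : realType} {L : language R} {M : structure L}.
Implicit Types (s t : M -> M) (B : set (meq M)).

Lemma definable0_automorphism (V : Type) (theta : (V -> M) -> R) s
    (v : V -> M) :
  definable0 theta -> automorphism s -> theta (s \o v) = theta v.
Proof.
move=> def sA; apply/eqP; rewrite -subr_eq0 -normr_le0.
apply/ler_addgt0Pl => e e0.
have [|phi phiP] := def (e / 2); first by rewrite divr_gt0.
have := phiP (s \o v); have := phiP v; rewrite eval_automorphism//.
by rewrite addr0 !ler_norml => /andP[? ?] /andP[? ?]; apply/andP; split; lra.
Qed.

Lemma fixes_comp s t c : fixes s c -> fixes t c -> fixes (s \o t) c.
Proof.
by case: c => [a|n d] /= sc tc; [rewrite tc|move=> x; rewrite -compA sc].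
Qed.

Lemma fixes_inv s t c : cancel s t -> cancel t s -> fixes s c -> fixes t c.
Proof.
move=> st ts; case: c => [a|n d] /= sc; first by rewrite -{1}sc st.
by move=> x; rewrite -sc; congr ival; apply/funext => i /=; rewrite ts.
Qed.

Lemma aut_over_comp B s t : aut_over B s -> aut_over B t -> aut_over B (s \o t).
Proof.
move=> [sA sB] [tA tB]; split; first exact: automorphism_comp.
by move=> b Bb; apply: fixes_comp; [exact: sB|exact: tB].
Qed.

Lemma aut_over_inv B s : aut_over B s ->
  exists2 t, aut_over B t & cancel s t /\ cancel t s.
Proof.
move=> [sA sB]; have [t tA [st ts]] := automorphism_inv sA.
by exists t => //; split => // b Bb; exact: fixes_inv st ts (sB b Bb).
Qed.

Lemma imaginary_conj n (d : imaginary M n) s : automorphism s ->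
  exists d' : imaginary M n, ival d' = fun x => ival d (s \o x).
Proof.
move=> sA; have [t tA [st ts]] := automorphism_inv sA.
have [b bE] := ival_inst d.
have inst : exists b', forall x, ival d (s \o x) = isort d (vsum x b').
  exists (t \o b) => x; rewrite bE.
  rewrite -[RHS](definable0_automorphism _ (isort_def d) sA).
  by congr isort; apply/funext => -[i|i] //=; rewrite ts.
by exists (Imaginary (isort_def d) inst).
Qed.

Lemma acleq_real_conj B s a : aut_over B s ->
  acleq B (mreal a) -> acleq B (mreal (s a)).
Proof.
move=> sB; have [t tB [st ts]] := aut_over_inv sB.
rewrite /acleq /=; set X := (X in compact X); set Y := (Y in _ -> compact Y).
suff -> : X = Y by [].
apply/seteqP; split => _ [u uB <-].
  by exists (u \o t); [exact: aut_over_comp|rewrite /= st].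
by exists (u \o s) => //; exact: aut_over_comp.
Qed.

Lemma acleq_imaginary_conj B s n (d d' : imaginary M n) : aut_over B s ->
  ival d' = (fun x => ival d (s \o x)) ->
  acleq B (mimag d) -> acleq B (mimag d').
Proof.
move=> sB d'E; have [t tB [st ts]] := aut_over_inv sB.
rewrite /acleq /= d'E.
set X := (X in compact X); set Y := (Y in _ -> compact Y).
suff -> : X = Y by [].
apply/seteqP; split => _ [u uB <-].
  exists (t \o u); first exact: aut_over_comp.
  by apply/funext => x; congr ival; apply/funext => i /=; rewrite ts.
by exists (s \o u) => //; exact: aut_over_comp.
Qed.

(** An automorphism over [B] permutes acl(B), so conjugating by it preserves the group of
    automorphisms fixing acl(B) pointwise. *)
Lemma over_acleq_conj B s n (psi : ('I_n -> M) -> R) : aut_over B s ->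
  over (acleq B) psi -> over (acleq B) (fun x => psi (s \o x)).
Proof.
move=> sB [_ [d -> <-] dB]; have [t tB [st ts]] := aut_over_inv sB.
have [d' d'E] := imaginary_conj d sB.1.
exists (mimag d'); first by exists d'.
move=> u [uA uB] x; rewrite d'E.
have conjB : aut_over (acleq B) (s \o u \o t).
  split; first exact: automorphism_comp (automorphism_comp sB.1 uA) tB.1.
  case=> [a|k d0] aB /=.
    by have /= -> := uB _ (acleq_real_conj tB aB); rewrite ts.
  move=> y; have [d1 d1E] := imaginary_conj d0 sB.1.
  have /(_ (t \o y)) := uB _ (acleq_imaginary_conj sB d1E aB).
  rewrite /= d1E => h; rewrite -[LHS]/(ival d0 (s \o (u \o (t \o y)))) h.
  by congr ival; apply/funext => i /=; rewrite ts.
rewrite -(dB _ conjB (s \o x)); congr ival.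
by apply/funext => i /=; rewrite st.
Qed.

(* A real element is interdefinable with the canonical parameter of d(x, a). *)
Lemma meq_imaginary (c : meq M) : exists n (d : imaginary M n),
  forall s, automorphism s -> fixes s c <-> fixes s (mimag d).
Proof.
case: c => [a|n d]; last by exists n, d.
pose theta (v : 'I_1 + nat -> M) := mdist (v (inl ord0)) (v (inr 0%N)).
have thetaD : definable0 theta.
  move=> e e0; exists (fdist (tvar L (inl ord0)) (tvar L (inr 0%N))) => v.
  by rewrite subrr normr0 ltW.
have inst : exists b, forall x : 'I_1 -> M, mdist (x ord0) a = theta (vsum x b).
  by exists (fun=> a).
exists 1%N, (Imaginary thetaD inst) => s [_ sd _ _] /=.
split => [sa x|/(_ (fun=> a))].
  by rewrite -{1}sa sd.
by rewrite mdistxx => /mdist_positivity.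
Qed.

End Imaginaries.

(** * The global non-forking extension of a stationary type *)

Section Stationary.
Context {R : realType} {L : language R} {M : structure L}.
Context {m : nat} {A : set M} {p : ctype m A} (hp : stationary p).
Context {q : ctype m [set: M]} (qp : extends (@subsetT M A) q p)
  (qA : nonforking A q).
Implicit Types (s : M -> M) (C : set M).

Lemma gvalue_val (phi : formula L ('I_m + [set: M])) : gvalue q phi val = q phi.
Proof.
rewrite /gvalue -[in RHS](formula_map_id phi); congr (tval q (formula_map _ _)).
by apply/funext => -[i|x] //=; congr inr; exact: val_inj.
Qed.

Lemma gvalue_extends (phi : formula L ('I_m + A)) : gvalue q phi val = p phi.
Proof.
rewrite -qp /gvalue; congr (tval q (formula_map _ _)).
by apply/funext => -[i|x] //=; congr inr; exact: val_inj.
Qed.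

Lemma gvalue_definition n (phi : formula L ('I_m + 'I_n)) :
  exists psi, [/\ phi_type phi psi, over (acleq (@mreal R L M @` A)) psi &
    forall b, psi b = gvalue q phi b].
Proof.
have [psi [h1 h2 h3]] := qA phi; exists psi; split => // b.
exact: (h2 (gparam \o b)).
Qed.

Lemma restriction_fin s C (k : nat) (phi : 'I_k -> formula L ('I_m + C))
    (e : R) : automorphism s -> 0 < e -> exists a : 'I_m -> M,
  forall i, `|gvalue q (phi i) (s \o val) - eval (phi i) (vsum a val)| <= e.
Proof.
move=> sA e0; have [t tA [st ts]] := automorphism_inv sA.
have [a aP] := tval_fin q
  (fun i => formula_map (vsum inl (inr \o (gparam \o (s \o val)))) (phi i)) e0.
exists (t \o a) => i; have := aP i; rewrite eval_vsum_map.
rewrite -[eval (phi i) (vsum (t \o a) _)](eval_automorphism _ _ sA).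
congr (`|_ - eval _ _| <= _).
by apply/funext => -[j|x] /=; rewrite ?ts.
Qed.

(* The conjugate of [q] by [s], restricted to [C]. *)
Definition restriction s C (sA : automorphism s) : ctype m C :=
  @CType _ _ _ m C (fun phi => gvalue q phi (s \o val))
    (fun k phi e => @restriction_fin s C k phi e sA).

Lemma restriction_extends s C (AC : A `<=` C) (sA : automorphism s) :
  (forall x, A x -> s x = x) -> extends AC (restriction C sA) p.
Proof.
move=> sA1 phi; rewrite /= gvalue_map -gvalue_extends; congr gvalue.
by apply/funext => x /=; rewrite sA1//; exact/set_mem/valP.
Qed.

Lemma restriction_nonforking s C (sA : automorphism s) :
  (forall x, A x -> s x = x) -> nonforking A (restriction C sA).
Proof.
move=> sA1 n phi; have [psi [psi_phi psiA psiE]] := gvalue_definition phi.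
exists (fun b => psi (s \o b)); split.
- move=> k b e e0; have [a aP] := psi_phi k (fun i => s \o b i) e e0.
  have [t tA [st ts]] := automorphism_inv sA.
  exists (t \o a) => i; have := aP i.
  rewrite -[eval phi (vsum (t \o a) _)](eval_automorphism _ _ sA).
  congr (`|_ - eval _ _| <= _).
  by apply/funext => -[j|x] /=; rewrite ?ts.
- by move=> b; rewrite psiE /= gvalue_map.
- by apply: over_acleq_conj => //; split => // _ [x Ax <-]; exact: sA1.
Qed.

(** The conjugate of [q] by [s] is again a non-forking extension of [p], so stationarity identifies
    it with [q]. *)
Lemma stationary_ginvariant s : automorphism s -> (forall x, A x -> s x = x) ->
  ginvariant q s.
Proof.
move=> sA sA1 phi; have [q0 [_ q0u]] := hp (@subsetT M A).
have qE : q = restriction [set: M] sA.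
  rewrite -(q0u q)//; apply: q0u; split; first exact: restriction_extends.
  exact: restriction_nonforking.
have := congr1 (fun r : ctype m _ =>
  r (formula_map (vsum inl (inr \o gparam)) phi)) qE.
by rewrite /= gvalue_map => h; exact: esym h.
Qed.

(** The type of [a] over [C] and the restriction of [q] to [C], obtained from the identity
    automorphism, are both non-forking extensions of [p]. *)
Lemma stationary_generic a C : A `<=` C -> realises a p ->
  nonforking A (tp a C) -> generic q a C.
Proof.
move=> AC ap aC phi; have [q0 [_ q0u]] := hp AC.
have qE : tp a C = restriction C (@automorphism_id _ _ M).
  rewrite -(q0u (tp a C)).
    apply: q0u; split; first exact: restriction_extends.
    exact: restriction_nonforking.
  split => // psi; rewrite -ap /= eval_map; congr eval.
  by apply/funext; case.
exact: (congr1 (fun r : ctype m C => r phi) qE).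
Qed.

Lemma morley_gseq I : morley_sequence p I -> gseq q A I.
Proof.
by move=> [Ip II] n; apply: stationary_generic => //; exact: II.
Qed.

(** A formula has finitely many parameters, so its value in [q] is given by a definition whose
    canonical parameter lies in Cb(p). *)
Lemma ginvariant_Cb s : aut_over (Cb p) s -> ginvariant q s.
Proof.
move=> [sA sCb] phi.
have [n [b [phi0 ->]]] := formula_finite_params phi; rewrite !gvalue_map.
have [psi [_ [c [d cE dE] _] psiE]] := gvalue_definition phi0.
have /sCb : Cb p c.
  exists q; split => //; exists n, phi0, psi; split; last by exists d.
  move=> b'; rewrite psiE /gvalue; congr (tval q (formula_map _ _)).
  by apply/funext => -[i|x] //=; congr inr; exact: val_inj.
by rewrite cE /= dE => /(_ b); rewrite !psiE.
Qed.

Lemma Cb_gvalue c : Cb p c -> exists n (phi : formula L ('I_m + 'I_n))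
  (d : imaginary M n), c = mimag d /\ forall b, ival d b = gvalue q phi b.
Proof.
move=> [q' [q'p q'A [n [phi [psi [psiE [d cE dE]]]]]]].
have [q0 [_ q0u]] := hp (@subsetT M A).
have q'E : q' = q by rewrite -(q0u q)// -(q0u q').
exists n, phi, d; split => // b; rewrite dE -q'E.
exact: (psiE (gparam \o b)).
Qed.

End Stationary.

(** * Finite determination of imaginaries definable over a tail *)

Section DefinableClosure.
Context {R : realType} {L : language R} {K : Type} {M : structure L}.
Context (limK : strong_limit K) (sat : saturated K M)
  (hom : strongly_homogeneous K M).

(** Expresses 1 - |u - w| by the available connectives, so that a lower bound on |u - w| becomes a
    condition. *)
Lemma fsubt_abs (u w : R) : 0 <= u <= 1 -> 0 <= w <= 1 ->
  Num.max (1 - Num.max (u - w) 0 - Num.max (w - u) 0) 0 = 1 - `|u - w|.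
Proof.
move=> /andP[u0 u1] /andP[w0 w1]; have [uw|/ltW wu] := leP u w.
  rewrite (max_r (x := u - w)) ?subr_le0// (max_l (x := w - u)) ?subr_ge0//.
  rewrite distrC ger0_norm ?subr_ge0// subr0; apply/max_l; lra.
rewrite (max_l (x := u - w)) ?subr_ge0// (max_r (x := w - u)) ?subr_le0//.
rewrite ger0_norm ?subr_ge0// subr0; apply/max_l; lra.
Qed.

(* Compactness: otherwise some automorphism over the whole tail would move
   [d]. *)
Lemma dcleq_tail_finite m (I : nat -> 'I_m -> M) k n (d : imaginary M n)
    (e : R) : dcleq (@mreal R L M @` tail I k) (mimag d) -> 0 < e ->
  exists N, forall s, automorphism s ->
    (forall i, (k <= i)%N -> (i < N)%N -> s \o I i = I i) ->
    forall x, `|ival d (s \o x) - ival d x| <= e.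
Proof.
move=> dI e0; apply: contrapT => bad.
have [b bE] := ival_inst d.
(* With an error e / 8 at each of two points, a variation of [d] above e is seen as at least e / 2,
   while no variation is seen as at most e / 4. *)
have [|phi phiP] := isort_def d (e := e / 8); first by rewrite divr_gt0.
have [l [y [phi0 phiE]]] := formula_finite_params phi.
pose b0 := b \o y.
have approx x : `|ival d x - eval phi0 (vsum x b0)| <= e / 8.
  by have := phiP (vsum x b); rewrite -bE phiE eval_vsum_map.
pose tl (w : nat * 'I_m) := I (k + w.1)%N w.2.
pose ev := vsum b0 tl.
(* The unknowns are a point x and a conjugate of [b0]; the parameters are [b0] and the tail. *)
pose U : finType := ('I_n + 'I_l)%type; pose V := ('I_l + nat * 'I_m)%type.
pose u : formula L (U + V) := formula_map (vsum (inl \o inl) (inl \o inr)) phi0.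
pose w : formula L (U + V) := formula_map (vsum (inl \o inl) (inr \o inl)) phi0.
pose delta := fsubt (fneg (fsubt u w)) (fsubt w u).
pose up (chi : formula L V) : formula L (U + V) :=
  formula_map (vsum (inl \o inr) (inr \o inr)) chi.
have uE (a : U -> M) : eval u (vsum a ev) = eval phi0 a.
  by rewrite eval_map; congr eval; apply/funext; case.
have wE (a : U -> M) : eval w (vsum a ev) = eval phi0 (vsum (a \o inl) b0).
  by rewrite eval_map; congr eval; apply/funext; case.
have deltaE (a : U -> M) : eval delta (vsum a ev) =
    1 - `|eval phi0 a - eval phi0 (vsum (a \o inl) b0)|.
  rewrite /delta /= fsubt_abs; [|exact: eval_itv|exact: eval_itv].
  by rewrite uE wE.
have upE chi (a : U -> M) :
    eval (up chi) (vsum a ev) = eval chi (vsum (a \o inr) tl).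
  by rewrite eval_map; congr eval; apply/funext; case.
pose W N (a : U -> M) := exists t, [/\ automorphism t,
  forall i, (k <= i)%N -> (i < N)%N -> t \o I i = I i, a \o inr = t \o b0 &
  e / 2 <= `|eval phi0 a - eval phi0 (vsum (a \o inl) b0)|].
have Wex N : exists a, W N a.
  apply: contrapT => nW; apply: bad; exists N => s sA sI x.
  rewrite leNgt; apply/negP => ltx; apply: nW.
  have [t tA [st ts]] := automorphism_inv sA.
  exists (vsum x (t \o b0)), t; split => //.
    move=> i ki iN; apply/funext => j /=; rewrite -[in LHS](sI i ki iN) /=.
    exact: st.
  have -> : eval phi0 (vsum x (t \o b0)) = eval phi0 (vsum (s \o x) b0).
    rewrite -(eval_automorphism _ _ sA); congr eval.
    by apply/funext => -[i|i] //=; rewrite ts.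
  rewrite -[_ \o inl]/x; have := approx x; have := approx (s \o x).
  rewrite !ler_norml => /andP[? ?] /andP[? ?]; rewrite leNgt; apply/negP.
  rewrite ltr_norml => /andP[? ?]; move: ltx; rewrite ltNge ler_norml => /negP.
  by apply; apply/andP; split; lra.
have Wmono N N' a : (N <= N')%N -> W N' a -> W N a.
  move=> NN' [t [tA tI at_ ta]]; exists t; split => // i ki iN.
  by apply: tI => //; exact: leq_trans iN NN'.
(* The conditions say that the unknown conjugate has the type of [b0] over the tail, and that
   replacing [b0] by it changes the value at x by at least e / 2. *)
pose S : set (condition L (U + V)) := [set c | c = (delta, 1 - e / 2) \/
  exists chi, c = (up chi, eval chi ev) \/
    c = (fneg (up chi), 1 - eval chi ev)].
(* A formula mentions only finitely many terms of the tail, and all of them are fixed once [N] is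
   large. *)
have bounded chi : exists N, forall a, W N a ->
    eval (up chi) (vsum a ev) = eval chi ev.
  have [r [g [chi0 ->]]] := formula_finite_support chi.
  pose idx (v : V) := if v is inr z then z.1 else 0%N.
  exists (k + \max_(i < r) (idx (g i)).+1)%N => a [t [tA tI at_ _]].
  rewrite upE !eval_map -[RHS](eval_automorphism _ _ tA); congr eval.
  apply/funext => i /=; have := @leq_bigmax _ (fun i => (idx (g i)).+1) i.
  case: (g i) => [j|[i' j]] /= hi; first by rewrite -[LHS]/((a \o inr) j) at_.
  rewrite -(ltn_add2l k) in hi.
  by have /(congr1 (@^~ j)) := tI _ (leq_addr i' k) hi.
have Sfin c : S c -> exists N, forall a, W N a -> eval c.1 (vsum a ev) <= c.2.
  move=> [->|[chi cE]].
    by exists 0%N => a [t [_ _ _ ta]]; rewrite [X in X <= _]deltaE lerD2l lerN2.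
  have [N NP] := bounded chi; exists N => a /NP aE.
  by case: cE => -> /=; rewrite aE.
have evsm : small K (range ev).
  apply: countable_small => //; apply: card_le_trans (card_image_le ev _) _.
  exact: countableP.
have [||a aS] := @saturated_family _ _ K M U V ev S sat.
- exact: evsm.
- move=> r c eps eps0 Sc.
  have /choice[N NP] i := Sfin _ (Sc i).
  have [a Wa] := Wex (\max_(i < r) N i)%N; exists a => i.
  apply: le_trans (NP i a _) _; last by rewrite lerDl ltW.
  by apply: Wmono Wa; exact: leq_bigmax.
have [||s sA sE] := @homogeneous_family _ _ K M V ev (vsum (a \o inr) tl) hom.
- exact: evsm.
- move=> chi; apply/eqP; rewrite eq_le; apply/andP; split.
    have := aS (fneg (up chi), 1 - eval chi ev).
    by rewrite /= upE lerD2l lerN2; apply; right; exists chi; right.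
  have := aS (up chi, eval chi ev).
  by rewrite /= upE; apply; right; exists chi; left.
(* The automorphism [s] fixes the whole tail, hence [d], which contradicts the condition on
   [delta]. *)
have fixd : fixes s (mimag d).
  apply: dI; split => // _ [_ [i /= ki [j _ <-]] <-] /=.
  by have /= := sE (inr ((i - k)%N, j)); rewrite /tl /= subnKC.
have [t tA [st ts]] := automorphism_inv sA.
have aE : eval phi0 a = eval phi0 (vsum (t \o (a \o inl)) b0).
  rewrite -[RHS](eval_automorphism _ _ sA); congr eval.
  by apply/funext => -[i|i] /=; rewrite ?ts // -[b0 i]/(ev (inl i)) sE.
have ivalE : ival d (t \o (a \o inl)) = ival d (a \o inl).
  rewrite -fixd; congr ival; apply/funext => i /=; exact: ts.
have := aS (delta, 1 - e / 2) (or_introl erefl); rewrite [X in X <= _]deltaE aE.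
have := approx (a \o inl); have := approx (t \o (a \o inl)); rewrite ivalE.
rewrite !ler_norml => /andP[h1 h2] /andP[h3 h4]; rewrite lerD2l lerN2 leNgt.
by rewrite ltr_norml; lra.
Qed.

End DefinableClosure.

(** * The two inclusions between the canonical base and the tail closure *)

Section CanonicalBase.
Context {R : realType} {L : language R} {T : theory L} (hT : stable T).
Context {K : Type} {M : structure L} (hM : monster K M T).
Context {m : nat} {A : set M} (hA : small K A).
Context {p : ctype m A} (hp : stationary p).
Context {I : nat -> 'I_m -> M} (hI : morley_sequence p I).

Lemma Cb_sub_tdcleq : Cb p `<=` tdcleq I.
Proof.
have [MT limK _ sat hom] := hM.
have [q [[qp qA] _]] := hp (@subsetT M A).
have Ainv := stationary_ginvariant hp qp qA.
have IA := morley_gseq hp qp qA hI.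
move=> c /(Cb_gvalue hp qp qA)[n [phi [d [-> dE]]]] k _ s [sA sI] x.
rewrite !dE; apply/eqP; rewrite -subr_eq0 -normr_le0.
apply/ler_addgt0Pl => e e0.
have e2 : 0 < e / 2 by rewrite divr_gt0.
have nop := hT MT (phi := phi).
have [N1 N1P] := gseq_cvg limK sat hom hA Ainv x IA e2 nop.
have [N2 N2P] := gseq_cvg limK sat hom hA Ainv (s \o x) IA e2 nop.
(* At this index both approximations hold and the term lies in the tail fixed by [s]. *)
pose i := maxn k (maxn N1 N2).
have := N1P i; rewrite !leq_max leqnn !orbT => /(_ isT).
have := N2P i; rewrite !leq_max leqnn !orbT => /(_ isT).
have -> : eval phi (vsum (I i) (s \o x)) = eval phi (vsum (I i) x).
  rewrite -[RHS](eval_automorphism _ _ sA); congr eval.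
  apply/funext => -[j|j] //=; apply/esym/(sI (mreal (I i j))).
  by exists (I i j) => //; exists i => //; exact: leq_maxl.
rewrite addr0 !ltr_norml ler_norml => /andP[? ?] /andP[? ?].
by apply/andP; split; lra.
Qed.

(* A generic continuation [g] of both [I 0, ..., I (N0 - 1)] and its image by
   [s] links [c] to its image: [c] is almost determined by [I i] for [i < N0],
   and also by [I i] for [N0 <= i < N1]. *)
Lemma tdcleq_sub_dcleq_Cb : tdcleq I `<=` dcleq (Cb p).
Proof.
have [MT limK _ sat hom] := hM.
have [q [[qp qA] _]] := hp (@subsetT M A).
have Ainv := stationary_ginvariant hp qp qA.
have IA := morley_gseq hp qp qA hI.
move=> c cI s sCb; have sA := sCb.1; have sq := ginvariant_Cb qp qA sCb.
have [n [d cd]] := meq_imaginary c.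
have dI k : dcleq (@mreal R L M @` tail I k) (mimag d).
  by move=> u uI; apply/cd; [exact: uI.1|exact: cI uI].
apply/(cd _ sA) => x; apply/eqP; rewrite -subr_eq0 -normr_le0.
apply/ler_addgt0Pl => e e0; have e3 : 0 < e / 3 by rewrite divr_gt0.
have [N0 N0P] := dcleq_tail_finite limK sat hom (dI 0%N) e3.
have [N1 N1P] := dcleq_tail_finite limK sat hom (dI N0) e3.
pose D := A `|` \bigcup_(k in [set k | (k < N0)%N]) range (I k).
have Dsm : small K (D `|` s @` D).
  apply: small_setU_le => //; last exact: card_image_le.
  apply: small_setU_finite => //; apply: bigcup_finite => [|k _].
    exact: finite_II.
  exact/finite_image/finite_finset.
have [g gD] := gseq_ex q limK sat Dsm.
have [t tA [st ts]] := automorphism_inv sA.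
have tq := ginvariantV ts sq.
(* Both sequences start with the first [N0] terms of [I]. Since [g] is generic over the image of [D]
   by [s], its preimage under [s] is generic over [D], which makes [a2] a Morley sequence too. *)
pose a1 n := if (n < N0)%N then I n else g (n - N0)%N.
pose a2 n := if (n < N0)%N then I n else t \o g (n - N0)%N.
have a1A : gseq q A a1 by apply: gseq_splice IA gD _; exact: subsetUl.
have a2A : gseq q A a2.
  apply: gseq_splice IA (gseq_image tA tq gD) _ => y Dy.
  by exists (s y); [right; exact: imageP|exact: st].
have [r1 [r1A _ r1I]] :=
    gseq_conj limK hom Ainv (maxn N0 N1) (@subset_refl _ A) hA IA a1A.
have [r2 [r2A _ r2I]] :=
    gseq_conj limK hom Ainv (maxn N0 N1) (@subset_refl _ A) hA IA a2A.
have [t1 t1A [r1t t1r]] := automorphism_inv r1A.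
have [t2 t2A [r2t t2r]] := automorphism_inv r2A.
have r1F i : (0 <= i)%N -> (i < N0)%N -> r1 \o I i = I i.
  by move=> _ iN; rewrite r1I ?leq_max ?iN// /a1 iN.
have r2F i : (0 <= i)%N -> (i < N0)%N -> r2 \o I i = I i.
  by move=> _ iN; rewrite r2I ?leq_max ?iN// /a2 iN.
(* On these terms [r2] leads to the preimage of [g] under [s], [s] brings it to [g], and [t1]
   returns to [I]. *)
have rG i : (N0 <= i)%N -> (i < N1)%N -> (t1 \o s \o r2) \o I i = I i.
  move=> Ni iN; have iM : (i < maxn N0 N1)%N by rewrite leq_max iN orbT.
  apply/funext => j /=; have /(congr1 (@^~ j)) /= -> := r2I _ iM.
  rewrite /a2 ltnNge Ni /= ts; have /(congr1 (@^~ j)) /= := r1I _ iM.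
  by rewrite /a1 ltnNge Ni /= => <-; rewrite r1t.
(* Three steps of size e / 3 lead from the value at [s \o x] to the value at [x], through
   [t1 \o (s \o x)] and [t2 \o x]. *)
have h1 := N0P _ r1A r1F (t1 \o (s \o x)).
have h2 := N0P _ r2A r2F (t2 \o x).
have h3 := N1P _ (automorphism_comp (automorphism_comp t1A sA) r2A) rG
  (t2 \o x).
have x1 : r1 \o (t1 \o (s \o x)) = s \o x by apply/funext => i /=; exact: t1r.
have x2 : r2 \o (t2 \o x) = x by apply/funext => i /=; exact: t2r.
have x3 : t1 \o s \o r2 \o (t2 \o x) = t1 \o (s \o x).
  by apply/funext => i /=; rewrite t2r.
move: h1 h2 h3; rewrite x1 x2 x3 addr0 !ler_norml.
move=> /andP[? ?] /andP[? ?] /andP[? ?].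
by apply/andP; split; lra.
Qed.

End CanonicalBase.

Theorem theorem5p5 (R : realType) (L : language R) (T : theory L)
    (hT : stable T)
    (K : Type) (M : structure L) (hM : monster K M T)
    (m : nat) (A : set M) (hA : small K A)
    (p : ctype m A) (hp : stationary p)
    (I : nat -> 'I_m -> M) (hI : morley_sequence p I) :
  dcleq (tdcleq I) = dcleq (Cb p).
Proof.
apply/seteqP; split => c cI s [sA sB]; apply: cI; split => // b bI.
  exact: (tdcleq_sub_dcleq_Cb hM hA hp hI bI).
exact/sB/(Cb_sub_tdcleq hT hM hA hp hI).
Qed.
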